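(* Let $m\in\mathbb N$ be a constant ($m\le O(1)$) and let $q>0$. Consider: (1) $m$ (sequences of) normed vector spaces $(E_1,\|\cdot\|_1),\dots,(E_m,\|\cdot\|_m)$; (2) $m$ (sequences of) norms or semi-norms $\|\cdot\|_1',\dots,\|\cdot\|_m'$, defined on $E_1,\dots,E_m$ respectively; (3) $m$ (sequences of) random vectors $Z_1\in E_1,\dots,Z_m\in E_m$ such that $Z\equiv(Z_1,\dots,Z_m)\propto\mathcal E_q(\sigma)$ for some (sequence of) positive numbers $\sigma$, both for $\|(z_1,\dots,z_m)\|_{\ell^\infty}=\sup_{1\le i\le m}\|z_i\|_i$ and for $\|(z_1,\dots,z_m)\|'_{\ell^\infty}=\sup_{1\le i\le m}\|z_i\|'_i$ on $E=E_1\times\cdots\times E_m$; (4) a (sequence of) normed vector spaces $(F,\|\cdot\|)$ and a (sequence of) mappings $\phi:E_1\times\cdots\times E_m\to F$ such that for all $(z_1,\dots,z_m)\in E_1\times\cdots\times E_m$, all $i\in\{1,\dots,m\}$ and all $z_i'\in E_i$, $$\left\|\phi(z_1,\dots,z_m)-\phi(z_1,\dots,z_{i-1},z_i',z_{i+1},\dots,z_m)\right\|\le\frac{\prod_{j=1}^m\max(\|z_j\|_j',\mu_j)}{\max(\|z_i\|_i',\mu_i)}\,\|z_i-z_i'\|_i,$$ where $\mu_1,\dots,\mu_m>0$ are (sequences of) positive reals such that $\mu_i\ge\mathbb E[\|Z_i\|_i']$ and $\mu_i\ge O(\sigma)$ for every $i$. Then $$\phi(Z)\propto\max_{l\in\{1,\dots,m\}}\mathcal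 E_{q/l}\left(\sigma^l\mu^{(m-l)}\right).$$
   Context: All objects are sequences indexed by an (often omitted) index $\theta\in\Theta$ (e.g. dimensions). For nonnegative sequences, $a_\theta\le O(b_\theta)$ means that there is a constant $C>0$ independent of $\theta$ with $a_\theta\le Cb_\theta$ for all $\theta$; $a_\theta\ge O(b_\theta)$ means that there is a constant $C>0$ independent of $\theta$ with $a_\theta\ge Cb_\theta$ for all $\theta$. For a (sequence of) random vectors $Z$ in a normed or semi-normed space $(E,\|\cdot\|)$, $Z\propto\mathcal E_q(\sigma)$ means: there exist constants $C,c>0$, independent of the index, such that for all indices, all $1$-Lipschitz $f:E\to\mathbb R$ and all $t>0$, $\mathbb P(|f(Z)-\mathbb E[f(Z)]|\ge t)\le Ce^{-(t/(c\sigma))^q}$ (equivalently, up to the constants, with $\mathbb E[f(Z)]$ replaced by $f(Z')$ for an independent copy $Z'$ of $Z$, or by a median of $f(Z)$). $Y\propto\max_{l\in\{1,\dots,m\}}\mathcal E_{q_l}(\sigma_l)$ means that there exist constants $C,c>0$ such that for all indices, all $1$-Lipschitz $f$ and all $t>0$, $\mathbb P(|f(Y)-\mathbb E[f(Y)]|\ge t)\le C\max_{l}e^{-(t/(c\sigma_l))^{q_l}}$. For $(\mu_1,\dots,\mu_m)\in\mathbb R_+^m$ and $k\in\{1,\dots,m\}$, $\mu^{(k)}=\max_{1\le l_1<\dots<l_k\le m}\mu_{l_1}\cdots\mu_{l_k}$ (the product of the $k$ largest entries), and $\mu^{(0)}=1$. *)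

(* Defs.v *)
From HB Require Import structures.
From mathcomp Require Import all_boot all_order all_algebra.
From mathcomp Require Import all_classical all_reals all_analysis.
Import Order.TTheory GRing.Theory Num.Theory.
Import numFieldNormedType.Exports.

Set Implicit Arguments.
Unset Strict Implicit.
Unset Printing Implicit Defensive.

Local Open Scope classical_set_scope.
Local Open Scope ring_scope.

(* p x >= 0 and p 0 = 0 follow from these two axioms. *)
Definition is_seminorm (R : realType) (V : lmodType R) (p : V -> R) : Prop :=
  (forall x y : V, p (x + y) <= p x + p y) /\
  (forall (a : R) (x : V), p (a *: x) = `|a| * p x).

Definition linf (R : realType) (m : nat) (E : 'I_m -> Type)
    (N : forall i, E i -> R) (z : forall i, E i) : R :=
  \big[Num.max/0]_(i < m) N i (z i).

(* mu^(k): the maximum over l_1 < ... < l_k of mu_(l_1) ... mu_(l_k). The default value 0 is harmless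
   for positive mu and k <= m; for k = 0 the only subset is empty and the
   value is 1. *)
Definition top_prod (R : realType) (m : nat) (mu : 'I_m -> R) (k : nat) : R :=
  \big[Num.max/0]_(A : {set 'I_m} | #|A| == k) \prod_(i in A) mu i.

(* a >= O(b) *)
Definition ge_bigO (R : realType) (Theta : Type) (a b : Theta -> R) : Prop :=
  exists2 C : R, 0 < C & forall th, C * b th <= a th.

Section Concentration.
Variables (R : realType) (Theta : Type).
Variables (d : Theta -> measure_display) (Omega : forall th, measurableType (d th)).
Variable P : forall th, probability (Omega th) R.
Variable E : Theta -> Type.

(* The (semi-)norm on E th enters only through dist x y = ||x - y||.
   Integrability of f \o Z says that f(Z) is a random variable and that E[f(Z)]
   is a real number. Asking that f \o Z be measurable for every 1-Lipschitz f
   is the same as asking that Z be Borel for the topology of dist, because a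
   closed set is the zero set of its distance function. *)
Definition concentrated_with (dist : forall th, E th -> E th -> R)
    (Z : forall th, Omega th -> E th) (tail : R -> Theta -> R -> R) : Prop :=
  exists C c : R, [/\ 0 < C, 0 < c &
    forall (th : Theta) (f : E th -> R),
      (forall x y, `|f x - f y| <= dist th x y) ->
      (P th).-integrable setT (EFin \o (f \o Z th)) /\
      forall t : R, 0 < t ->
        (P th [set w | (t <= `|f (Z th w) - fine 'E_(P th)[f \o Z th]|)%R]
           <= (C * tail c th t)%:E)%E].

Definition concentrated (dist : forall th, E th -> E th -> R)
    (Z : forall th, Omega th -> E th) (q : R) (sigma : Theta -> R) : Prop :=
  concentrated_with dist Z
    (fun c th t => expR (- (t / (c * sigma th)) `^ q)).

Definition max_concentrated (dist : forall th, E th -> E th -> R)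
    (Z : forall th, Omega th -> E th)
    (m : nat) (q : 'I_m -> R) (sigma : 'I_m -> Theta -> R) : Prop :=
  concentrated_with dist Z
    (fun c th t =>
       \big[Num.max/0]_(l < m) expR (- (t / (c * sigma l th)) `^ q l)).

End Concentration.

(* Main.v *)
(* On the box where every [N' i (z i)] is at most [mu i + s], the map [phi] is
   Lipschitz with constant [L s = \sum_i \prod_(j != i) 2 max(mu j, s)], so
   [f (phi z) / L s] has a 1-Lipschitz extension [g s] to the whole space.
   Both the probability of leaving the box and that of a deviation [s] of
   [g s (Z)] from its mean are at most of order [e s = exp (- (s / (c sigma))^q)],
   hence [f (phi Z)] deviates by [s * L s] with probability of that order. The
   centre is first made independent of [s], then replaced by the expectation.
   Finally [s * L s] is at most a constant times
   [\max_l s^l mu^(m - l)]; given [t], take the largest [s] for which all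
   [s^l mu^(m - l)] are below a constant multiple of [t]: the index [l] where the
   bound is tight gives the tail [exp (- (t / (c' sigma^l mu^(m - l)))^(q / l))]. *)

Require Import Defs.
From HB Require Import structures.
From mathcomp Require Import all_boot all_order all_algebra.
From mathcomp Require Import all_classical all_reals all_analysis.
From mathcomp Require Import measurable_realfun lra ring.
Import Order.TTheory GRing.Theory Num.Theory.
Import numFieldNormedType.Exports.

Set Implicit Arguments.
Unset Strict Implicit.
Unset Printing Implicit Defensive.

Local Open Scope classical_set_scope.
Local Open Scope ring_scope.

(** * Deviation events, geometric tails and stretched exponential tails *)

Lemma measurable_deviation (R : realType) (d : measure_display) (T : measurableType d)
    (Y : T -> R) (a t : R) :
  measurable_fun setT Y -> measurable [set w | t <= `|Y w - a|].
Proof.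
move=> mY.
have mW : measurable_fun setT (fun w => `|Y w - a|).
  by apply: measurableT_comp => //; apply: measurable_funB.
rewrite [X in measurable X](_ : _ = (fun w => `|Y w - a|) @^-1` `[t, +oo[).
  by rewrite -[X in measurable X]setTI; apply: mW.
by apply/seteqP; split => w /=; rewrite in_itv /= andbT.
Qed.

(** Each level [k] contributes at most [M ^ (k + 1) * C / (2 M) ^ k = M C / 2 ^ k], and these sum to
    at most [2 M C]. *)
Lemma expectation_le_geometric_tail (R : realType) (d : measure_display)
    (T : measurableType d) (P : probability T R) (W : T -> R) (M C : R) :
  1 < M -> 0 <= C -> measurable_fun setT W -> (forall w, 0 <= W w) ->
  (forall k, (P [set w | (M ^+ k <= W w)%R] <= (C / (2 * M) ^+ k)%:E)%E) ->
  (\int[P]_w (W w)%:E <= (1 + 2 * M * C)%:E)%E.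
Proof.
move=> M1 C0 mW W0 tailW.
have M0 : 0 < M by apply: lt_trans M1.
pose S k := [set w | M ^+ k <= W w].
have mS k : measurable (S k).
  have := @measurable_deviation _ _ _ W 0 (M ^+ k) mW.
  by congr measurable; apply/seteqP; split => w /=; rewrite subr0 ger0_norm.
pose g k w := (M ^+ k.+1 * \1_(S k) w)%:E.
have g0 k w : setT w -> (0 <= g k w)%E.
  by move=> _; rewrite lee_fin mulr_ge0// ?exprn_ge0// ltW.
have mg k : measurable_fun setT (g k).
  by apply/measurable_EFinP; apply: measurable_funM.
(* [W] exceeds 1 by at most the sum of the [M ^ (k + 1)] over the [k] with [M ^ k <= W]. *)
have W_le w : ((W w)%:E <= 1 + \sum_(0 <= k <oo) g k w)%E.
  have trunc n : ((Num.min (W w) (M ^+ n))%:E <= 1 + \sum_(0 <= k < n) g k w)%E.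
    elim: n => [|n IH].
      by rewrite big_nil adde0 lee_fin expr0 ge_min lexx orbT.
    rewrite big_nat_recr//= addeA.
    have [WM|MW] := ltP (W w) (M ^+ n).
      rewrite (_ : Num.min _ _ = Num.min (W w) (M ^+ n)).
        by apply: le_trans IH _; rewrite leeDl// g0.
      rewrite !min_l//; first exact: ltW.
      by apply: le_trans (ltW WM) _; rewrite ler_eXn2l// leqnSn.
    rewrite /g indicE mem_set ?mulr1//.
    have : (0 <= 1 + \sum_(0 <= k < n) g k w)%E.
      by apply: adde_ge0 => //; apply: sume_ge0 => k _; apply: g0.
    move=> h; apply: (@le_trans _ _ (M ^+ n.+1)%:E).
      by rewrite lee_fin ge_min lexx orbT.
    by rewrite leeDr.
  (* Bernoulli's inequality [n (M - 1) <= M ^ n] shows that the cap [M ^ n] is eventually inactive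
     at [w]. *)
  have [n nW] : exists n, W w <= M ^+ n.
    have M10 : 0 < M - 1 by rewrite subr_gt0.
    exists (Num.Def.archi_bound (W w / (M - 1))).
    set n := Num.Def.archi_bound _.
    have /ltW : W w / (M - 1) < n%:R.
      by apply: archi_boundP; rewrite divr_ge0// ltW.
    rewrite ler_pdivrMr// => h; apply: (le_trans h).
    elim: n {h} => [|n IH]; first by rewrite mul0r expr0.
    have e1 : 1 <= M ^+ n by rewrite exprn_ege1// ltW.
    have : (M - 1) * 1 <= (M - 1) * M ^+ n by rewrite ler_wpM2l// ltW.
    rewrite exprS -natr1 mulrDl; lra.
  have := trunc n; rewrite min_l// => /le_trans; apply.
  rewrite leeD2l//; apply: nneseries_lim_ge => k _ _; exact: g0.
have mser : measurable_fun setT (fun w => \sum_(0 <= k <oo) g k w)%E.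
  by apply: ge0_emeasurable_sum => // k w _ _; apply: g0.
have ser0 w : (0 <= \sum_(0 <= k <oo) g k w)%E.
  by apply: nneseries_ge0 => k _ _; apply: g0.
apply: (@le_trans _ _ (\int[P]_w (1 + \sum_(0 <= k <oo) g k w))%E).
  apply: ge0_le_integral => //.
  - by move=> w _; rewrite lee_fin.
  - exact/measurable_EFinP.
  - exact: emeasurable_funD.
rewrite ge0_integralD//=.
rewrite integral_cst//= probability_setT mul1e EFinD leeD2l//.
rewrite integral_nneseries//.
apply: lime_le.
  apply: is_cvg_nneseries => k _ _; apply: integral_ge0 => w _; exact: g0.
apply: nearW => n.
have gle k : (\int[P]_w g k w <= (M * C / 2 ^+ k)%:E)%E.
  rewrite /g; under eq_integral do rewrite EFinM.
  rewrite ge0_integralZl//; last 2 first.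
  - by apply/measurable_EFinP.
  - by rewrite lee_fin exprn_ge0// ltW.
  rewrite integral_indic// setIT.
  apply: (@le_trans _ _ ((M ^+ k.+1)%:E * (C / (2 * M) ^+ k)%:E)%E).
    apply: lee_wpmul2l; [by rewrite lee_fin exprn_ge0// ltW|exact: tailW].
  rewrite -EFinM lee_fin exprS exprMn invfM.
  rewrite le_eqVlt; apply/orP; left; apply/eqP.
  have Mk0 : M ^+ k != 0 by rewrite lt0r_neq0// exprn_gt0.
  have two_k0 : (2 : R) ^+ k != 0 by rewrite expf_neq0.
  by field; rewrite ?Mk0 ?two_k0.
apply: (@le_trans _ _ (\sum_(0 <= k < n) (M * C / 2 ^+ k)%:E)%E).
  by apply: lee_sum => k _; apply: gle.
rewrite sumEFin lee_fin.
suff -> : \sum_(0 <= k < n) M * C / 2 ^+ k = 2 * M * C - 2 * M * C / 2 ^+ n.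
  by rewrite gerBl divr_ge0// ?exprn_ge0// !mulr_ge0// ltW.
elim: n => [|n IH]; first by rewrite big_nil expr0 divr1 subrr.
rewrite big_nat_recr//= IH exprS.
have h : (2 : R) ^+ n != 0 by rewrite expf_neq0.
by field.
Qed.

Lemma le_expRN_powR (R : realType) (q x y : R) : 0 < q -> 0 <= x -> x <= y ->
  expR (- y `^ q) <= expR (- x `^ q).
Proof.
move=> q0 x0 xy; rewrite ler_expR lerN2; apply: ge0_ler_powR => //; rewrite ?(ltW q0)//.
by rewrite nnegrE (le_trans x0).
Qed.

(** With [N + 1 >= n / q] and [y = u ^ q], one has [u ^ n <= y ^ (N + 1)], and
    [y / (N + 1) <= exp (y / (N + 1))] raised to the power [N + 1] bounds this by
    [(N + 1) ^ (N + 1) * exp y]. *)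
Lemma expRN_powR_le (R : realType) (q : R) (n : nat) : 0 < q ->
  exists2 C : R, 0 < C & forall u, 1 <= u -> expR (- u `^ q) <= C / u ^+ n.
Proof.
move=> q0; pose N := (Num.Def.archi_bound (n%:R / q)).
have nN : n%:R <= q * N.+1%:R.
  rewrite mulrC -ler_pdivrMr//; apply: (@le_trans _ _ N%:R).
    by apply/ltW/archi_boundP; rewrite divr_ge0// ltW.
  by rewrite ler_nat.
exists (N.+1%:R ^+ N.+1); first by rewrite exprn_gt0.
move=> u u1; have u0 : 0 < u by apply: lt_le_trans u1.
have uq0 : 0 < u `^ q by apply: powR_gt0.
rewrite expRN ler_pdivlMr ?exprn_gt0// mulrC ler_pdivrMr ?expR_gt0//.
apply: (@le_trans _ _ ((u `^ q) ^+ N.+1)).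
  by rewrite -!powR_mulrn -?powRrM ?ler_powR// ltW.
have {2}-> : u `^ q = N.+1%:R * (u `^ q / N.+1%:R) by field.
rewrite expRM_natl -exprMn.
apply: lerXn2r; rewrite ?nnegrE; first exact: ltW.
  by rewrite mulr_ge0// expR_ge0.
rewrite mulrC -ler_pdivrMr//; apply: le_trans (expR_ge1Dx _).
by rewrite lerDr.
Qed.

(** * Recentring: one centre for all truncation levels, then the expectation *)

Lemma exists_outside_three (R : realType) (d : measure_display) (T : measurableType d)
    (P : probability T R) (A B C : set T) :
  measurable A -> measurable B -> measurable C ->
  (P A <= (1 / 4)%:E)%E -> (P B <= (1 / 4)%:E)%E -> (P C <= (1 / 4)%:E)%E ->
  exists w, [/\ ~ A w, ~ B w & ~ C w].
Proof.
move=> mA mB mC PA PB PC.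
have mAB : measurable (A `|` B) by apply: measurableU.
have : (P (A `|` B `|` C) <= (3 / 4)%:E)%E.
  apply: (le_trans (measureU2 _ mAB mC)).
  have -> : (3 / 4)%:E = ((1 / 4)%:E + (1 / 4)%:E + (1 / 4)%:E)%E :> \bar R.
    by rewrite -!EFinD; congr EFin; lra.
  rewrite leeD//; apply: (le_trans (measureU2 _ mA mB)); exact: leeD.
move=> Pu; apply: contrapT => noW.
have uT : A `|` B `|` C = setT.
  apply/seteqP; split => // w _; apply: contrapT => nw; apply: noW; exists w.
  by split => h; apply: nw; [left; left|left; right|right].
by move: Pu; rewrite uT probability_setT lee_fin; lra.
Qed.

(* The centres [a s] depend on the truncation level [s]; for [s >= s0] the
   functions [G s] and [G s0] agree on [A s0], and for [s0] large enough they are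
   close to [a s] and [a s0] at a common point of [A s0], so [a s0] serves as the
   centre at all levels. *)
Lemma concentration_of_truncations (R : realType) (q B : R) (d : measure_display)
    (T : measurableType d) (P : probability T R) (Y : T -> R) (rho : R)
    (tau : R -> R) (A : R -> set T) (G : R -> T -> R) (a : R -> R) :
  0 < q -> 1 <= B -> 0 < rho ->
  (forall s t, 0 < s -> s <= t -> tau s <= tau t) ->
  (forall s, measurable (A s)) -> (forall s t, s <= t -> A s `<=` A t) ->
  (forall w, exists s, A s w) ->
  (forall s, 0 < s -> measurable_fun setT (G s)) ->
  (forall s w, 0 < s -> A s w -> G s w = Y w) ->
  (forall s, 0 < s -> (P (~` A s) <= (B * expR (- (s / rho) `^ q))%:E)%E) ->
  (forall s, 0 < s -> (P [set w | (tau s <= `|G s w - a s|)%R] <=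
     (B * expR (- (s / rho) `^ q))%:E)%E) ->
  measurable_fun setT Y /\
  exists b : R, forall s, 0 < s ->
    (P [set w | (3 * tau s <= `|Y w - b|)%R] <=
      (4 * B * expR (- (s / rho) `^ q))%:E)%E.
Proof.
move=> q0 B1 rho0 tau_mono mA A_mono A_cover mG GY PA PG.
have B0 : 0 < B by apply: lt_le_trans B1.
have mY : measurable_fun setT Y.
  (* At each point the sequence [G (n + 1)] is eventually equal to [Y], since the sets [A s]
     increase to the whole space. *)
  apply: (@measurable_fun_cvg _ _ _ setT (fun n => G n.+1%:R)).
    by move=> n; apply: mG.
  move=> w _; have [s sw] := A_cover w.
  apply: cvg_near_cst; exists (Num.Def.archi_bound (Num.max s 0)) => // n /= hn.
  apply: GY => //; apply: (A_mono s) => //.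
  apply: (@le_trans _ _ (Num.max s 0)); first by rewrite le_max lexx.
  apply: (@le_trans _ _ n%:R); last by rewrite ler_nat.
  have /ltW h : Num.max s 0 < (Num.Def.archi_bound (Num.max s 0))%:R.
    by apply: archi_boundP; rewrite le_max lexx orbT.
  by apply: (le_trans h); rewrite ler_nat.
split => //.
have ln0 : 0 < ln (4 * B) by apply: ln_gt0; lra.
(* This level makes the tail equal to [1 / (4 B)]: below it the claimed bound is at least 1, and
   above it each bad event has probability at most 1/4. *)
pose s0 := rho * ln (4 * B) `^ q^-1.
have s00 : 0 < s0 by rewrite mulr_gt0// powR_gt0.
have e_s0 : expR (- (s0 / rho) `^ q) = (4 * B)^-1.
  rewrite /s0 mulrAC divff ?gt_eqF// mul1r -powRrM mulVf ?gt_eqF// powRr1 ?ltW//.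
  by rewrite expRN lnK// posrE; lra.
have e_mono s t : 0 < s -> s <= t ->
    expR (- (t / rho) `^ q) <= expR (- (s / rho) `^ q).
  move=> s_gt0 st; apply: le_expRN_powR => //.
    by rewrite divr_ge0// ltW.
  by rewrite ler_pM2r// invr_gt0.
exists (a s0) => s s_gt0.
have mdev : measurable [set w | 3 * tau s <= `|Y w - a s0|].
  exact: measurable_deviation.
have [ss0|s0s] := leP s s0.
  apply: (@le_trans _ _ 1%E); first exact: probability_le1.
  rewrite lee_fin; apply: (@le_trans _ _ (4 * B * expR (- (s0 / rho) `^ q))).
    by rewrite e_s0 divff//; lra.
  by rewrite ler_pM2l ?e_mono//; lra.
have small t : s0 <= t -> B * expR (- (t / rho) `^ q) <= 1 / 4.
  move=> s0t; apply: (@le_trans _ _ (B * expR (- (s0 / rho) `^ q))).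
    by rewrite ler_pM2l ?e_mono.
  by rewrite e_s0 invfM mulrCA divff ?gt_eqF// mulr1 mul1r.
have mDG t : 0 < t -> measurable [set w | tau t <= `|G t w - a t|].
  by move=> t0; apply: measurable_deviation; apply: mG.
have [w [Aw Gsw Gs0w]] : exists w, [/\ ~ (~` A s0) w,
    ~ [set w | tau s <= `|G s w - a s|] w &
    ~ [set w | tau s0 <= `|G s0 w - a s0|] w].
  apply: exists_outside_three.
  - exact: measurableC.
  - exact: mDG.
  - exact: mDG.
  - by apply: le_trans (PA _ s00) _; rewrite lee_fin small.
  - by apply: le_trans (PG _ s_gt0) _; rewrite lee_fin small// ltW.
  - by apply: le_trans (PG _ s00) _; rewrite lee_fin small.
have {}Aw : A s0 w by apply: contrapT.
have aa : `|a s - a s0| <= 2 * tau s.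
  move/negP: Gsw; move/negP: Gs0w; rewrite -!ltNge /= !GY//; last first.
    exact: A_mono (ltW s0s) _ Aw.
  move=> h1 h2; have h3 := tau_mono _ _ s00 (ltW s0s).
  rewrite (_ : a s - a s0 = (Y w - a s0) - (Y w - a s)); last by ring.
  apply: le_trans (ler_normB _ _) _; lra.
have mU : measurable (~` A s `|` [set w | tau s <= `|G s w - a s|]).
  by apply: measurableU; [exact: measurableC|exact: mDG].
(* The factor 3 is one [tau s] for the deviation from [a s] and two for the distance between the
   centres. *)
apply: (@le_trans _ _ (P (~` A s `|` [set w | tau s <= `|G s w - a s|]))).
  apply: le_measure; rewrite ?inE// => v /= hv.
  have [Av|] := pselect (A s v); last by left.
  right; rewrite /= GY//.
  have : `|Y v - a s0| <= `|Y v - a s| + `|a s - a s0|.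
    by rewrite (_ : Y v - a s0 = (Y v - a s) + (a s - a s0)) ?ler_normD//; ring.
  lra.
apply: (@le_trans _ _ (P (~` A s) + P [set w | (tau s <= `|G s w - a s|)%R])%E).
  by apply: measureU2; [exact: measurableC|exact: mDG].
apply: (le_trans (leeD (PA _ s_gt0) (PG _ s_gt0))).
rewrite -EFinD lee_fin -mulrDl ler_pM2r ?expR_gt0//; lra.
Qed.

(** Polynomial growth of [tau] against the exponential tail gives [E|Y - b| <= L * tau rho], so the
    mean lies that close to [b], which costs only a multiple of [tau s] once [s >= rho]. The
    constant [K] is fixed before the probability space, hence uniform in the index. *)
Lemma concentration_about_expectation (R : realType) (q B : R) (m : nat) :
  0 < q -> 1 <= B ->
  exists2 K : R, 0 < K & forall (d : measure_display) (T : measurableType d)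
    (P : probability T R) (Y : T -> R) (b rho : R) (tau : R -> R),
  0 < rho -> (forall s, 0 < s -> 0 < tau s) ->
  (forall s t, 0 < s -> s <= t -> tau s <= tau t) ->
  (forall u, 1 <= u -> tau (u * rho) <= u ^+ m * tau rho) ->
  measurable_fun setT Y ->
  (forall s, 0 < s -> (P [set w | (3 * tau s <= `|Y w - b|)%R] <=
      (B * expR (- (s / rho) `^ q))%:E)%E) ->
  P.-integrable setT (EFin \o Y) /\
  forall s, 0 < s ->
    (P [set w | (K * tau s <= `|Y w - fine 'E_P[Y]|)%R] <=
      (expR 1 * B * expR (- (s / rho) `^ q))%:E)%E.
Proof.
move=> q0 B1; have B0 : 0 < B by apply: lt_le_trans B1.
(* At [u = 2 ^ k], the growth [u ^ m] of [tau] is at most [M ^ k], while the decay [u ^ (m + 2)] is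
   exactly [(2 M) ^ k]. *)
pose M : R := 2 ^+ m.+1.
have M1 : 1 < M by rewrite /M exprn_egt1// ltr1n.
have [C0 C0_gt0 C0P] := expRN_powR_le m.+2 q0.
pose C := B * C0; have C_gt0 : 0 < C by rewrite mulr_gt0.
pose L := 3 * (1 + 2 * M * C).
have L0 : 0 < L.
  by rewrite /L mulr_gt0// addr_gt0// !mulr_gt0//; apply: lt_trans M1.
exists (3 + L); first by rewrite addr_gt0.
move=> d T P Y b rho tau rho0 tau0 tau_mono tau_scale mY PY.
have trho := tau0 _ rho0.
pose W w := `|Y w - b| / (3 * tau rho).
have t3 : 0 < 3 * tau rho by rewrite mulr_gt0.
have mYb : measurable_fun setT (fun w => `|Y w - b|).
  by apply: measurableT_comp => //; apply: measurable_funB.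
have mW : measurable_fun setT W by apply: measurable_funM.
have W0 w : 0 <= W w by rewrite divr_ge0// ltW.
have tailW k : (P [set w | (M ^+ k <= W w)%R] <= (C / (2 * M) ^+ k)%:E)%E.
  pose u : R := 2 ^+ k.
  have u1 : 1 <= u by rewrite exprn_ege1// ler1n.
  have u0 : 0 < u by apply: lt_le_trans u1.
  apply: (@le_trans _ _ (P [set w | 3 * tau (u * rho) <= `|Y w - b|])).
    apply: le_measure; rewrite ?inE.
    - have := @measurable_deviation _ _ _ W 0 (M ^+ k) mW.
      by congr measurable; apply/seteqP; split => w /=; rewrite subr0 ger0_norm.
    - exact: measurable_deviation.
    - move=> w /=; rewrite ler_pdivlMr// => h; apply: le_trans h.
      rewrite mulrCA ler_pM2l//; apply: (le_trans (tau_scale _ u1)).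
      rewrite ler_pM2r// /u /M -!exprM mulnC ler_weXn2l// ?ler1n// leq_mul2r leqnSn.
      by rewrite orbT.
  apply: (le_trans (PY _ (mulr_gt0 u0 rho0))).
  rewrite lee_fin mulfK ?gt_eqF// /C -mulrA ler_pM2l//.
  apply: (le_trans (C0P _ u1)).
  by rewrite /M /u -exprS -!exprM mulnC.
have intYb : (\int[P]_w `|(Y w - b)%:E| <= (L * tau rho)%:E)%E.
  have -> : (\int[P]_w `|(Y w - b)%:E| = \int[P]_w ((3 * tau rho)%:E * (W w)%:E))%E.
    apply: eq_integral => w _; rewrite -EFinM /W mulrC divfK ?gt_eqF//.
  rewrite ge0_integralZl//; last 3 first.
  - exact/measurable_EFinP.
  - by move=> w _; rewrite lee_fin.
  - by rewrite lee_fin ltW.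
  apply: (@le_trans _ _ ((3 * tau rho)%:E * (1 + 2 * M * C)%:E)%E).
    apply: lee_wpmul2l; first by rewrite lee_fin ltW.
    by apply: expectation_le_geometric_tail => //; exact: ltW.
  by rewrite -EFinM lee_fin /L mulrAC.
have iYb : P.-integrable setT (fun w => (Y w - b)%:E).
  apply/integrableP; split.
    by apply/measurable_EFinP; apply: measurable_funB.
  by apply: le_lt_trans intYb _; rewrite ltry.
have ib : P.-integrable setT (fun w => b%:E) by apply: finite_measure_integrable_cst.
have iY : P.-integrable setT (EFin \o Y).
  have -> : EFin \o Y = (fun w => (Y w - b)%:E) \+ (fun w => b%:E).
    by apply/funext => w /=; rewrite -EFinD subrK.
  exact: integrableD.
split=> // s s0.
have EYE : ('E_P[Y] = \int[P]_w (Y w)%:E)%E by rewrite unlock.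
have EY : `|fine 'E_P[Y] - b| <= L * tau rho.
  have -> : fine 'E_P[Y] - b = fine (\int[P]_w (Y w - b)%:E).
    have -> : (\int[P]_w (Y w - b)%:E = \int[P]_w (EFin (Y w)) - \int[P]_w b%:E)%E.
      by rewrite -integralB.
    rewrite integral_cst//= probability_setT mule1 EYE.
    by rewrite (fineB (integrable_fin_num measurableT iY)).
  rewrite -lee_fin; apply: le_trans intYb.
  apply: le_trans (le_abse_integral _ _ _) => //; last first.
    by apply/measurable_EFinP; apply: measurable_funB.
  rewrite -fine_abse ?fineK// ?abse_fin_num; exact: integrable_fin_num.
have mdev t c : measurable [set w | t <= `|Y w - c|] by apply: measurable_deviation.
(* For [s < rho] the tail is at least [exp (-1)], so the prefactor [expR 1 * B] makes the bound at
   least 1. *)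
have [rs|sr] := leP rho s; last first.
  apply: (@le_trans _ _ 1%E); first exact: probability_le1.
  rewrite lee_fin.
  have e1 : (expR 1)^-1 <= expR (- (s / rho) `^ q).
    rewrite -expRN.
    have -> : -1 = - (1 `^ q) :> R by rewrite powR1.
    apply: le_expRN_powR => //; first by rewrite divr_ge0// ltW.
    by rewrite ler_pdivrMr// mul1r ltW.
  have : expR 1 * B * (expR 1)^-1 <= expR 1 * B * expR (- (s / rho) `^ q).
    by rewrite ler_pM2l// mulr_gt0// expR_gt0.
  by apply: le_trans; rewrite mulrAC divff ?mul1r// gt_eqF// expR_gt0.
apply: (@le_trans _ _ (P [set w | 3 * tau s <= `|Y w - b|])).
  apply: le_measure; rewrite ?inE// => w /=.
  have : L * tau rho <= L * tau s by rewrite ler_pM2l// tau_mono.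
  have : `|Y w - fine 'E_P[Y]| <= `|Y w - b| + `|fine 'E_P[Y] - b|.
    rewrite (_ : Y w - fine 'E_P[Y] = (Y w - b) - (fine 'E_P[Y] - b)); last by ring.
    exact: ler_normB.
  rewrite mulrDl; lra.
apply: (le_trans (PY _ s0)); rewrite lee_fin -mulrA ler_peMl//.
  by rewrite mulr_ge0// ?expR_ge0// ltW.
by have := expR_ge1Dx (1 : R); lra.
Qed.

(** * Union bound and extension of Lipschitz functions *)

Lemma union_bound (R : realType) (d : measure_display) (T : measurableType d)
    (P : probability T R) (I : finType) (U : I -> set T) (A : set T) (x : R) :
  (forall i, measurable (U i)) -> measurable A ->
  (forall w, A w -> exists i, U i w) ->
  (forall i, (P (U i) <= x%:E)%E) -> (P A <= (#|I|%:R * x)%:E)%E.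
Proof.
move=> mU mA AU PU.
have mUs (r : seq I) : measurable (\big[setU/set0]_(i <- r) U i).
  by apply: bigsetU_measurable.
apply: (@le_trans _ _ (P (\big[setU/set0]_(i <- index_enum I) U i))).
  apply: le_measure; rewrite ?inE//.
  move=> w /AU[i Uiw]; rewrite -bigcup_seq; exists i => //=.
  exact: mem_index_enum.
rewrite cardT enumT.
rewrite -[Finite.enum I]/(index_enum I); elim: (index_enum I) => [|i r IH].
  by rewrite big_nil measure0 mul0r.
rewrite big_cons; apply: (le_trans (measureU2 _ (mU i) (mUs r))).
by rewrite /= -natr1 mulrDl mul1r addrC EFinD leeD.
Qed.

(* McShane's extension: [g x] is the infimum of [h y + dist x y] over [y] in [A]. *)
Lemma lipschitz_extension (R : realType) (T : Type) (dist : T -> T -> R) (A : set T)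
    (h : T -> R) :
  A !=set0 -> (forall x, dist x x = 0) -> (forall x y, dist x y = dist y x) ->
  (forall x y z, dist x z <= dist x y + dist y z) ->
  (forall x y, A x -> A y -> `|h x - h y| <= dist x y) ->
  exists g : T -> R,
    (forall x y, `|g x - g y| <= dist x y) /\ (forall x, A x -> g x = h x).
Proof.
move=> A0 dist0 distC distD h_lip.
pose S x := [set h y + dist x y | y in A].
(* This lower bound makes the infimum finite and, with [y0 = x] in [A], shows that it is at least
   [h x]. *)
have S_lb x y0 : A y0 -> lbound (S x) (h y0 - dist x y0).
  move=> Ay0 _ [y Ay <-]; have := h_lip _ _ Ay0 Ay.
  rewrite ler_norml => /andP[_ h1].
  by have := distD y0 x y; rewrite (distC y0 x); lra.
have S_has x : has_lbound (S x).
  by have [y0 Ay0] := A0; exists (h y0 - dist x y0); apply: S_lb.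
have S0 x : S x !=set0 by have [y0 Ay0] := A0; exists (h y0 + dist x y0), y0.
exists (fun x => inf (S x)); split => [x y|x Ax].
  have half u v : inf (S u) - inf (S v) <= dist u v.
    rewrite lerBlDr -lerBlDl; apply: lb_le_inf => // _ [z Az <-].
    rewrite lerBlDl; apply: (@le_trans _ _ (h z + dist u z)).
      by apply: ge_inf => //; exists z.
    by have := distD u v z; lra.
  rewrite ler_norml half andbT.
  by have := half y x; rewrite distC; lra.
apply/eqP; rewrite eq_le; apply/andP; split.
  by apply: ge_inf => //; exists x => //; rewrite dist0 addr0.
by apply: lb_le_inf => //; have := S_lb x x Ax; rewrite dist0 subr0.
Qed.

(** * Seminorms and the sup distance on a product *)

Lemma seminorm0 (R : realType) (V : lmodType R) (p : V -> R) :
  is_seminorm p -> p 0 = 0.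
Proof. by move=> [_ pZ]; have := pZ 0 0; rewrite scale0r normr0 mul0r. Qed.

Lemma seminormB (R : realType) (V : lmodType R) (p : V -> R) (x y : V) :
  is_seminorm p -> p (x - y) = p (y - x).
Proof. by move=> [_ pZ]; have := pZ (-1) (y - x); rewrite scaleN1r opprB normrN1 mul1r. Qed.

Lemma seminorm_lipschitz (R : realType) (V : lmodType R) (p : V -> R) (x y : V) :
  is_seminorm p -> `|p x - p y| <= p (x - y).
Proof.
move=> p_sn; have [pD _] := p_sn.
rewrite ler_norml; apply/andP; split.
  by have := pD (y - x) x; rewrite subrK (seminormB _ _ p_sn); lra.
by have := pD (x - y) y; rewrite subrK; lra.
Qed.

Lemma norm_seminorm (R : realType) (V : normedModType R) :
  is_seminorm (fun x : V => `|x|).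
Proof. by split => [x y|a x]; [exact: ler_normD|exact: normrZ]. Qed.

Section LinfDistance.
Variables (R : realType) (m : nat) (E : 'I_m -> lmodType R) (N : forall i, E i -> R).
Arguments N : clear implicits.
Hypothesis N_seminorm : forall i, is_seminorm (N i).
Implicit Types x y z : forall i, E i.

Let dist x y := linf N (fun i => x i - y i).

Lemma le_linf x i : N i (x i) <= linf N x.
Proof. exact: (le_bigmax 0 (fun i => N i (x i))). Qed.

Lemma linf_le x r : 0 <= r -> (forall i, N i (x i) <= r) -> linf N x <= r.
Proof. by move=> r0 xr; apply: bigmax_le. Qed.

Lemma linf_ge0 x : 0 <= linf N x.
Proof. exact: bigmax_ge_id. Qed.

Lemma linf_dist0 x : dist x x = 0.
Proof.
apply/eqP; rewrite eq_le linf_ge0 andbT; apply: linf_le => // i.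
by rewrite subrr seminorm0.
Qed.

Lemma linf_distC x y : dist x y = dist y x.
Proof. by apply: eq_bigr => i _; rewrite seminormB. Qed.

Lemma linf_distD x y z : dist x z <= dist x y + dist y z.
Proof.
apply: linf_le => [|i]; first by rewrite addr_ge0// linf_ge0.
have [ND _] := N_seminorm i.
rewrite -(subrKA (y i)); apply: (le_trans (ND _ _)); apply: lerD.
  exact: (le_linf (fun i => x i - y i)).
exact: (le_linf (fun i => y i - z i)).
Qed.

(** Through this, concentration of [Z] for the primed sup distance applies to each [N' i (Z i)]. *)
Lemma coord_lipschitz i x y : `|N i (x i) - N i (y i)| <= dist x y.
Proof.
apply: (le_trans (seminorm_lipschitz _ _ (N_seminorm i))).
exact: (le_linf (fun i => x i - y i)).
Qed.

End LinfDistance.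

(** * Lipschitz constants on boxes and the choice of level *)

Definition lip_bound (R : realType) (m : nat) (mu : 'I_m -> R) (s : R) : R :=
  \sum_(i < m) \prod_(j < m | j != i) (2 * Num.max (mu j) s).

(* Pass from [z] to [z'] one coordinate at a time; the intermediate points stay
   in the box where every [N' j] is at most [mu j + s]. *)
Lemma lipschitz_on_box (R : realType) (m : nat) (E : 'I_m -> normedModType R)
    (N' : forall i, E i -> R) (F : normedModType R) (phi : (forall i, E i) -> F)
    (mu : 'I_m -> R) (s : R) :
  (forall i, 0 < mu i) ->
  (forall (z : forall i, E i) (i : 'I_m) (zi' : E i),
       `|phi z - phi (dfwith z i zi')|
         <= (\prod_(j < m) Num.max (N' j (z j)) (mu j))
            / Num.max (N' i (z i)) (mu i) * `|z i - zi'|) ->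
  forall z z' : forall i, E i,
    (forall i, N' i (z i) <= mu i + s) -> (forall i, N' i (z' i) <= mu i + s) ->
    `|phi z - phi z'| <=
      lip_bound mu s * linf (fun i (x : E i) => `|x|) (fun i => z i - z' i).
Proof.
move=> mu0 phi_lip z z' zs z's.
(* The path from [z] to [z']: the first [k] coordinates are already replaced. *)
pose h (k : nat) : forall i, E i := fun j => if (j < k)%N then z' j else z j.
have hs k j : N' j (h k j) <= mu j + s by rewrite /h; case: ifP.
have h0 : h 0%N = z by apply: functional_extensionality_dep.
have hm : h m = z'.
  by apply: functional_extensionality_dep => j; rewrite /h ltn_ord.
have hS (i : 'I_m) : h i.+1 = dfwith (h i) i (z' i).
  apply: functional_extensionality_dep => j.
  have [<-|ij] := eqVneq i j; first by rewrite dfwithin /h ltnS leqnn.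
  by rewrite dfwithout// /h ltnS leq_eqVlt (inj_eq val_inj) eq_sym (negbTE ij).
have -> : phi z - phi z' = \sum_(i < m) (phi (h i) - phi (h i.+1)).
  rewrite -[in LHS]h0 -[in LHS]hm -opprB -(telescope_sumr (fun k => phi (h k)))//.
  by rewrite big_mkord -sumrN; apply: eq_bigr => i _; rewrite opprB.
apply: (le_trans (ler_norm_sum _ _ _)).
rewrite /lip_bound mulr_suml; apply: ler_sum => i _.
rewrite hS; apply: (le_trans (phi_lip _ _ _)).
apply: ler_pM => //.
- apply: divr_ge0; last by rewrite le_max (ltW (mu0 i)) orbT.
  by apply: prodr_ge0 => j _; rewrite le_max (ltW (mu0 j)) orbT.
- rewrite (bigD1 i)//= mulrAC divff ?mul1r; last first.
    by rewrite gt_eqF// lt_max mu0 orbT.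
  (* Both [mu j + s] and [mu j] are at most [2 * max (mu j) s]. *)
  apply: ler_prod => j _; rewrite le_max (ltW (mu0 j)) orbT /= ge_max.
  apply/andP; split.
    apply: (le_trans (hs _ _)).
    have : mu j <= Num.max (mu j) s by rewrite le_max lexx.
    have : s <= Num.max (mu j) s by rewrite le_max lexx orbT.
    lra.
  have : mu j <= Num.max (mu j) s by rewrite le_max lexx.
  have := mu0 j; lra.
- have -> : h i i = z i by rewrite /h ltnn.
  exact: (le_linf (fun i (x : E i) => `|x|) (fun i => z i - z' i)).
Qed.

Section LipBound.
Variables (R : realType) (m : nat) (mu : 'I_m -> R).
Hypothesis mu0 : forall i, 0 < mu i.

Lemma lip_bound_gt0 (i0 : 'I_m) s : 0 < lip_bound mu s.
Proof.
have p0 i : 0 < \prod_(j < m | j != i) (2 * Num.max (mu j) s).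
  by apply: prodr_gt0 => j _; rewrite mulr_gt0// lt_max mu0.
by rewrite /lip_bound (bigD1 i0)//= ltr_wpDr// sumr_ge0// => i _; rewrite ltW.
Qed.

Lemma lip_bound_mono s t : s <= t -> lip_bound mu s <= lip_bound mu t.
Proof.
move=> st; apply: ler_sum => i _; apply: ler_prod => j _.
rewrite mulr_ge0 ?le_max ?(ltW (mu0 j))//=.
by rewrite ler_pM2l// ge_max !le_max lexx st orbT.
Qed.

(** Each product has [m - 1] factors, each growing by at most [u]; the extra [u] comes from the
    factor [s] in [s * lip_bound mu s]. *)
Lemma lip_bound_scale u s : 1 <= u -> 0 < s ->
  u * lip_bound mu (u * s) <= u ^+ m * lip_bound mu s.
Proof.
move=> u1 s0; have u0 : 0 < u by apply: lt_le_trans u1.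
rewrite /lip_bound !mulr_sumr; apply: ler_sum => i _.
have -> : u ^+ m = u * u ^+ #|predC1 i|.
  by rewrite cardC1 card_ord -exprS (ltn_predK (ltn_ord i)).
rewrite -mulrA ler_pM2l// -prodr_const -big_split/=; apply: ler_prod => j _.
rewrite mulr_ge0 ?le_max ?(ltW (mu0 j))//= mulrCA ler_pM2l// maxr_pMr ?(ltW u0)//.
rewrite ge_max !le_max lexx orbT andbT; apply/orP; left.
by rewrite ler_peMl// ltW.
Qed.

Lemma top_prod_gt0 k : (k <= m)%N -> 0 < top_prod mu k.
Proof.
move=> km; pose A : {set 'I_m} := [set widen_ord km i | i : 'I_k].
have cA : #|A| == k.
  by rewrite card_imset ?card_ord// => x y /(congr1 val) /= /val_inj.
apply: (@lt_le_trans _ _ (\prod_(i in A) mu i)); first exact: prodr_gt0.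
exact: (@le_bigmax_cond _ _ _ 0 A (fun A : {set 'I_m} => #|A| == k)).
Qed.

(** In the product that omits [i], let [S] collect the [j] with [mu j < s]. With the outer [s] they
    give [s ^ (#|S| + 1)], and the other [m - (#|S| + 1)] entries multiply to at most the
    corresponding [top_prod], so the hypothesis applies at [l = #|S|]. *)
Lemma lip_bound_le_top_prod s x : 0 < s ->
  (forall l : 'I_m, s ^+ l.+1 * top_prod mu (m - l.+1) <= x) ->
  s * lip_bound mu s <= m%:R * 2 ^+ m * x.
Proof.
move=> s0 sx; rewrite /lip_bound mulr_sumr.
have -> : m%:R * 2 ^+ m * x = \sum_(i < m) (2 ^+ m * x).
  by rewrite sumr_const card_ord -mulrA mulr_natl.
apply: ler_sum => i _.
pose S := [set j | (j != i) && (mu j < s)]%SET.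
have Sm : (#|S| < m)%N.
  rewrite -[X in (_ < X)%N]card_ord; apply: proper_card; apply/properP; split.
    exact: subset_predT.
  by exists i => //; rewrite inE eqxx.
have x0 : 0 < x.
  apply: lt_le_trans (sx (Ordinal Sm)).
  by rewrite mulr_gt0 ?exprn_gt0// top_prod_gt0// leq_subr.
have -> : \prod_(j < m | j != i) (2 * Num.max (mu j) s) =
    2 ^+ m.-1 * (s ^+ #|S| * \prod_(j | (j != i) && ~~ (mu j < s)) mu j).
  rewrite big_split/= prodr_const cardC1 card_ord; congr (_ * _).
  rewrite (bigID (fun j => mu j < s))/=; congr (_ * _); last first.
    by apply: eq_bigr => j /andP[_]; rewrite -leNgt => h; rewrite max_l.
  rewrite -prodr_const; apply: eq_big => [j|j /andP[_ h]]; first by rewrite inE.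
  by rewrite max_r// ltW.
rewrite mulrCA; apply: ler_pM; rewrite ?exprn_ge0//.
- rewrite !mulr_ge0 ?exprn_ge0 ?(ltW s0)//.
  by apply: prodr_ge0 => j _; rewrite ltW.
- by rewrite ler_weXn2l ?ler1n// leq_pred.
- apply: le_trans (sx (Ordinal Sm)); rewrite mulrA -exprS ler_pM2l ?exprn_gt0//=.
  pose D := [set j | (j != i) && ~~ (mu j < s)]%SET.
  rewrite (eq_bigl (mem D)); last by move=> j; rewrite !inE.
  apply: (@le_bigmax_cond _ _ _ 0 D (fun A : {set 'I_m} => #|A| == (m - #|S|.+1)%N)).
  have -> : D = (~: (i |: S))%SET.
    by apply/setP => j; rewrite !inE negb_or negb_and negbK; case: eqP.
  by rewrite cardsCs finset.setCK cardsU1 inE eqxx card_ord.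
Qed.

End LipBound.

(** Each [level l] solves [s ^ (l + 1) * D l = t / H]. The smallest one satisfies all the
    constraints and is tight at its own index. *)
Lemma exists_level (R : realType) (m : nat) (q rho H t : R) (D : 'I_m -> R) :
  (0 < m)%N -> 0 < rho -> 0 < H -> 0 < t -> (forall l, 0 < D l) ->
  exists s, [/\ 0 < s, forall l : 'I_m, s ^+ l.+1 * D l <= t / H &
    exists l : 'I_m, (s / rho) `^ q =
      (t / (H * rho ^+ l.+1 * D l)) `^ (q / l.+1%:R)].
Proof.
move=> m0 rho0 H0 t0 D0.
pose r (l : 'I_m) := t / (H * rho ^+ l.+1 * D l).
have r0 l : 0 < r l by rewrite divr_gt0// !mulr_gt0// exprn_gt0.
pose level (l : 'I_m) := rho * r l `^ l.+1%:R^-1.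
have level0 l : 0 < level l by rewrite mulr_gt0// powR_gt0.
have levelX l : level l ^+ l.+1 * D l = t / H.
  rewrite exprMn -(powR_mulrn _ (powR_ge0 _ _)) -powRrM mulVf ?pnatr_eq0//.
  rewrite powRr1 ?ltW// /r.
  have : rho ^+ l.+1 != 0 by rewrite gt_eqF// exprn_gt0.
  have : D l != 0 by rewrite gt_eqF.
  have : H != 0 by rewrite gt_eqF.
  by move=> h1 h2 h3; field; rewrite h1 h2 h3.
have [l _ l_min] := @arg_minP _ _ _ (Ordinal m0) xpredT level isT.
exists (level l); split => // [k|].
  rewrite -(levelX k) ler_pM2r// lerXn2r ?nnegrE ?l_min// ltW//.
exists l; rewrite /level mulrAC divff ?gt_eqF// mul1r -powRrM.
by rewrite mulrC.
Qed.

(** * Concentration of the image under [phi] *)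

Theorem theorem5p1 (R : realType) (m : nat) (q : R) (q_gt0 : 0 < q)
    (Theta : Type)
    (d : Theta -> measure_display)
    (Omega : forall th : Theta, measurableType (d th))
    (P : forall th : Theta, probability (Omega th) R)
    (E : Theta -> 'I_m -> normedModType R)
    (N' : forall (th : Theta) (i : 'I_m), E th i -> R)
    (N'_seminorm : forall (th : Theta) (i : 'I_m), is_seminorm (N' th i))
    (Z : forall th : Theta, Omega th -> forall i : 'I_m, E th i)
    (sigma : Theta -> R) (sigma_gt0 : forall th, 0 < sigma th)
    (Z_conc : concentrated P
       (fun th z z' => linf (fun i (x : E th i) => `|x|) (fun i => z i - z' i))
       Z q sigma)
    (Z_conc' : concentrated P
       (fun th z z' => linf (N' th) (fun i => z i - z' i))
       Z q sigma)
    (F : Theta -> normedModType R)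
    (phi : forall th : Theta, (forall i : 'I_m, E th i) -> F th)
    (mu : 'I_m -> Theta -> R) (mu_gt0 : forall i th, 0 < mu i th)
    (mu_ge_mean : forall i th,
       ('E_(P th)[fun w => N' th i (Z th w i)] <= (mu i th)%:E)%E)
    (mu_ge_sigma : forall i, ge_bigO (mu i) sigma)
    (phi_lip : forall (th : Theta) (z : forall i : 'I_m, E th i) (i : 'I_m)
         (zi' : E th i),
       `|phi th z - phi th (dfwith z i zi')|
         <= (\prod_(j < m) Num.max (N' th j (z j)) (mu j th))
            / Num.max (N' th i (z i)) (mu i th)
            * `|z i - zi'|) :
  max_concentrated P
    (fun th (x y : F th) => `|x - y|)
    (fun th w => phi th (Z th w))
    (fun l : 'I_m => q / l.+1%:R)
    (fun (l : 'I_m) th =>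
       sigma th ^+ l.+1 * top_prod (fun i => mu i th) (m - l.+1)).
Proof.
(* Without coordinates [phi (Z)] is constant; the empty maximum defaults to 0, which suffices
   because every deviation event is empty. *)
have [m0|m_gt0] := posnP m.
  exists 1, 1; split => // th f _.
  pose c := f (phi th (fun i => 0)).
  have fphiE w : f (phi th (Z th w)) = c.
    congr (f (phi th _)); apply: functional_extensionality_dep => i.
    by have := ltn_ord i; rewrite [X in (_ < X)%N]m0.
  have -> : f \o (fun w => phi th (Z th w)) = cst c.
    by apply/funext => w /=; rewrite fphiE.
  split=> [|t t0]; first exact: finite_measure_integrable_cst.
  rewrite expectation_cst/= [X in P th X](_ : _ = set0).
    rewrite measure0 lee_fin mul1r; exact: bigmax_ge_id.
  by apply/seteqP; split => w //=; rewrite fphiE subrr normr0 leNgt t0.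
have [C1 [c1 [C1_gt0 c1_gt0 conc]]] := Z_conc.
have [C2 [c2 [C2_gt0 c2_gt0 conc']]] := Z_conc'.
pose c := Num.max c1 c2.
have c_gt0 : 0 < c by rewrite lt_max c1_gt0.
(* [C1] serves the Lipschitz extensions, [m * C2] the union bound over the coordinates, and 1
   ensures [B >= 1]. *)
pose B := 1 + C1 + m%:R * C2.
have mC2 : 0 < m%:R * C2 by rewrite mulr_gt0// ltr0n.
have B1 : 1 <= B by rewrite /B; lra.
have B4 : 1 <= 4 * B by lra.
have [K K0 KP] := concentration_about_expectation m q_gt0 B4.
(* [K] is the cost of centring at the mean, [m * 2 ^ m] that of comparing [s * lip s] with the
   products [top_prod]. *)
pose H := K * (m%:R * 2 ^+ m).
have H0 : 0 < H by rewrite !mulr_gt0 ?exprn_gt0// ltr0n.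
(* Since [cmax >= 1], the power [cmax ^ m] dominates every [c ^ (l + 1)] contained in
   [rho ^ (l + 1)]. *)
pose cmax := Num.max 1 c.
exists (expR 1 * (4 * B)), (H * cmax ^+ m); split.
- by rewrite !mulr_gt0 ?expR_gt0//; lra.
- by rewrite mulr_gt0// exprn_gt0// lt_max ltr01.
move=> th f f_lip.
pose muth i := mu i th.
have muth0 i : 0 < muth i by apply: mu_gt0.
pose rho := c * sigma th.
have rho0 : 0 < rho by rewrite mulr_gt0.
pose lip := lip_bound muth.
have lip0 s : 0 < lip s by apply: lip_bound_gt0 => //; exact: (Ordinal m_gt0).
pose tau s := s * lip s.
pose e s := expR (- (s / rho) `^ q).
have e_ge c' s : 0 < c' -> c' <= c -> 0 < s ->
    expR (- (s / (c' * sigma th)) `^ q) <= e s.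
  move=> c'0 c'c s0; apply: le_expRN_powR => //.
    by rewrite divr_ge0// ltW.
  by rewrite ler_pM2l// lef_pV2 ?posrE ?mulr_gt0// ler_pM2r.
pose box s := [set z : forall i, E th i | forall i, N' th i (z i) <= muth i + s].
pose A s := [set w | box s (Z th w)].
pose X i w := N' th i (Z th w i).
have X_conc i : (P th).-integrable setT (EFin \o X i) /\
    forall t, 0 < t -> (P th [set w | (t <= `|X i w - fine 'E_(P th)[X i]|)%R]
           <= (C2 * expR (- (t / (c2 * sigma th)) `^ q))%:E)%E.
  by apply: (conc' th (fun z => N' th i (z i))) => x y; apply: coord_lipschitz.
have mX i : measurable_fun setT (X i).
  by apply/measurable_EFinP; apply: measurable_int (X_conc i).1.
have EX i : fine 'E_(P th)[X i] <= muth i.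
  rewrite -lee_fin fineK ?mu_ge_mean//.
  by rewrite unlock; apply: integrable_fin_num => //; have [] := X_conc i.
have mA s : measurable (A s).
  rewrite [A s](_ : _ = \bigcap_(i in [set: 'I_m]) (X i @^-1` `]-oo, muth i + s])).
    apply: fin_bigcap_measurable => // i _.
    by rewrite -[X in measurable X]setTI; apply: mX.
  apply/seteqP; split => w /= h i; first by move=> _; rewrite /= in_itv /=; exact: h.
  by have := h i I; rewrite /= in_itv.
have box_mono s t : s <= t -> box s `<=` box t.
  by move=> st z zs i; apply: (le_trans (zs i)); rewrite lerD2l.
have A_cover w : exists s, A s w.
  exists (linf (N' th) (Z th w)) => i.
  by apply: (le_trans (@le_linf _ _ (fun i => E th i) (N' th) (Z th w) i)); rewrite lerDr ltW.
have PA s : 0 < s -> (P th (~` A s) <= (B * e s)%:E)%E.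
  move=> s0; apply: (@le_trans _ _ (m%:R * (C2 * e s))%:E); last first.
    rewrite lee_fin mulrA ler_pM2r ?expR_gt0// /B; lra.
  rewrite -[m in m%:R]card_ord; apply: (@union_bound _ _ _ _ _
    (fun i => [set w | s <= `|X i w - fine 'E_(P th)[X i]|])).
  - by move=> i; apply: measurable_deviation.
  - exact: measurableC.
  (* Leaving the box means [X i > mu i + s] for some [i], a deviation above [s] since the mean of
     [X i] is at most [mu i]. *)
  - move=> w /= Aw; apply: contrapT => noi; apply: Aw => i.
    rewrite leNgt; apply/negP => lti; apply: noi; exists i => /=.
    have := EX i; have := ler_norm (X i w - fine 'E_(P th)[X i]).
    rewrite /X in lti *; lra.
  - move=> i; apply: (le_trans ((X_conc i).2 _ s0)).
    by rewrite lee_fin ler_pM2l// e_ge// le_max lexx orbT.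
pose Y w := f (phi th (Z th w)).
(* The positivity of [s] stands inside the existential so that [choice] yields a family indexed by
   all reals. *)
have ext s : exists g : (forall i, E th i) -> R, 0 < s ->
    (forall z z', `|g z - g z'| <= linf (fun i (x : E th i) => `|x|) (fun i => z i - z' i))
    /\ (forall z, box s z -> g z = f (phi th z) / lip s).
  have [s0|s0] := ltP 0 s; last by exists (fun=> 0).
  have sn i : is_seminorm (fun x : E th i => `|x|) by apply: norm_seminorm.
  have box0 : box s !=set0.
    exists (fun i => 0) => i; rewrite (seminorm0 (N'_seminorm th i)).
    by rewrite ltW// addr_gt0.
  have h_lip z z' : box s z -> box s z' ->
      `|f (phi th z) / lip s - f (phi th z') / lip s| <=
        linf (fun i (x : E th i) => `|x|) (fun i => z i - z' i).
    move=> zs z's; rewrite -mulrBl normrM normfV (gtr0_norm (lip0 s)).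
    rewrite ler_pdivrMr// mulrC; apply: (le_trans (f_lip _ _)).
    exact: lipschitz_on_box.
  have [g [g_lip gE]] := lipschitz_extension box0
    (@linf_dist0 _ _ (fun i => E th i) _ sn)
    (@linf_distC _ _ (fun i => E th i) _ sn)
    (@linf_distD _ _ (fun i => E th i) _ sn) h_lip.
  by exists g.
have [g gP] := choice ext.
(* Undoing the normalisation turns a deviation [s] of [g s] into [tau s = s * lip s]. *)
pose G s w := lip s * g s (Z th w).
pose a s := lip s * fine 'E_(P th)[g s \o Z th].
have g_conc s (s0 : 0 < s) := conc th (g s) (gP s s0).1.
have mG s : 0 < s -> measurable_fun setT (G s).
  move=> s0; apply: measurable_funM => //.
  by apply/measurable_EFinP; apply: measurable_int (g_conc s s0).1.
have GY s w : 0 < s -> A s w -> G s w = Y w.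
  by move=> s0 Asw; rewrite /G (gP s s0).2// mulrC divfK// gt_eqF.
have PG s : 0 < s -> (P th [set w | (tau s <= `|G s w - a s|)%R] <= (B * e s)%:E)%E.
  move=> s0; rewrite [X in P th X](_ : _ =
      [set w | s <= `|g s (Z th w) - fine 'E_(P th)[g s \o Z th]|]).
    apply: (le_trans ((g_conc s s0).2 _ s0)); rewrite lee_fin.
    apply: (@le_trans _ _ (C1 * e s)).
      by rewrite ler_pM2l// e_ge// le_max lexx.
    by rewrite ler_pM2r ?expR_gt0// /B; lra.
  apply/seteqP; split => w /=; rewrite /G /a -mulrBr normrM (gtr0_norm (lip0 s)) /tau;
    by rewrite [s * _]mulrC ler_pM2l.
have tau_mono s t : 0 < s -> s <= t -> tau s <= tau t.
  move=> s0 st; apply: ler_pM => //; rewrite ?(ltW s0) ?(ltW (lip0 _))//.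
  exact: lip_bound_mono.
have tau_gt0 s : 0 < s -> 0 < tau s by move=> s0; rewrite mulr_gt0.
have [mY [b Yb]] := concentration_of_truncations q_gt0 B1 rho0 tau_mono mA
  (fun s t st w => box_mono s t st (Z th w)) A_cover mG GY PA PG.
have tau_scale u : 1 <= u -> tau (u * rho) <= u ^+ m * tau rho.
  move=> u1; have := lip_bound_scale muth0 u1 rho0.
  by rewrite -(ler_pM2l rho0) /tau /lip; congr (_ <= _); ring.
have [iY Y_conc] := KP _ _ (P th) Y b rho tau rho0 tau_gt0 tau_mono tau_scale mY Yb.
split => // t t0.
pose D (l : 'I_m) := top_prod muth (m - l.+1).
have D0 l : 0 < D l by apply: top_prod_gt0 => //; exact: leq_subr.
have [s [s0 sD [l sl]]] := exists_level q m_gt0 rho0 H0 t0 D0.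
(* The chosen level satisfies [K * tau s <= t], so a deviation of [t] is one of [K * tau s]. *)
apply: (@le_trans _ _ (expR 1 * (4 * B) * e s)%:E).
  apply: le_trans (Y_conc s s0); apply: le_measure; rewrite ?inE.
  - exact: measurable_deviation.
  - exact: measurable_deviation.
  - move=> w /=; apply: le_trans.
    rewrite -ler_pdivlMl//; apply: (le_trans (lip_bound_le_top_prod muth0 s0 sD)).
    rewrite le_eqVlt; apply/orP; left; apply/eqP; rewrite /H.
    have : K != 0 by rewrite gt_eqF.
    have : (2 : R) ^+ m != 0 by rewrite expf_neq0.
    have : m%:R != 0 :> R by rewrite pnatr_eq0 -lt0n.
    by move=> h1 h2 h3; field; rewrite h1 h2 h3.
rewrite lee_fin ler_pM2l; last by rewrite !mulr_gt0 ?expR_gt0//; lra.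
apply: le_trans (le_bigmax 0 (fun l : 'I_m => expR (- (t / (H * cmax ^+ m *
  (sigma th ^+ l.+1 * D l))) `^ (q / l.+1%:R))) l).
have den1 : 0 < H * rho ^+ l.+1 * D l.
  by do 2!apply: mulr_gt0 => //; apply: exprn_gt0.
have den2 : 0 < H * cmax ^+ m * (sigma th ^+ l.+1 * D l).
  by apply: mulr_gt0; apply: mulr_gt0 => //; apply: exprn_gt0; rewrite // lt_max ltr01.
rewrite /e sl; apply: le_expRN_powR; first by rewrite divr_gt0.
  by rewrite divr_ge0 ?ltW.
rewrite ler_pM2l// lef_pV2 ?posrE//.
rewrite mulrA ler_pM2r// -mulrA ler_pM2l// exprMn ler_pM2r; last by rewrite exprn_gt0.
apply: (@le_trans _ _ (cmax ^+ l.+1)).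
  have c_cmax : c <= cmax by rewrite le_max lexx orbT.
  by apply: lerXn2r => //; rewrite nnegrE ?(le_trans _ c_cmax)// ltW.
by rewrite ler_weXn2l// le_max lexx.
Qed.
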